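(* Let $X$ be a real normed linear space with $\dim X\ge 2$ and let $0\le p\le 1$. Then $X$ is an inner product space (that is, its norm is induced by an inner product) if and only if $\mathcal{MR}_p(X)=1$.
   Context: For $p\in\mathbb{R}$ and nonzero $x_1,x_2\in X$, the $p$-angular distance and the skew $p$-angular distance are $$\alpha_p[x_1,x_2]=\left\|\frac{x_1}{\|x_1\|^{1-p}}-\frac{x_2}{\|x_2\|^{1-p}}\right\|,\qquad \beta_p[x_1,x_2]=\left\|\frac{x_1}{\|x_2\|^{1-p}}-\frac{x_2}{\|x_1\|^{1-p}}\right\|.$$ For $0\le p\le 1$ the Maligranda-Rooin constant of a normed space $X$ is $$\mathcal{MR}_p(X)=\sup\left\{\frac{\alpha_p[x_1,x_2]}{\beta_p[x_1,x_2]}:\ x_1,x_2\in X\setminus\{0\},\ \beta_p[x_1,x_2]\ne 0\right\}.$$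
   Formalization: The implication from MR_p(X)=1 to X being an inner product space is stated only for p<1: at p=1 the two distances coincide, so MR_1(X)=1 for every X (e.g. the plane with the sup norm) and the claim fails; the converse is kept for all 0≤p≤1. *)

(* Defs.v *)
From HB Require Import structures.
From mathcomp Require Import all_boot all_order all_algebra.
From mathcomp Require Import all_classical all_reals all_analysis.

Set Implicit Arguments.
Unset Strict Implicit.
Unset Printing Implicit Defensive.

Import Order.TTheory GRing.Theory Num.Theory.
Import numFieldNormedType.Exports.

Local Open Scope classical_set_scope.
Local Open Scope ring_scope.

(* The power [`^] is the real power [powR]; it is the usual one on the positive
   bases occurring below, [x1] and [x2] being nonzero wherever these distances
   are used. *)
Definition p_angular_dist (R : realType) (X : normedModType R) (p : R)
    (x1 x2 : X) : R :=
  `|(`|x1| `^ (1 - p))^-1 *: x1 - (`|x2| `^ (1 - p))^-1 *: x2|.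

Definition skew_p_angular_dist (R : realType) (X : normedModType R) (p : R)
    (x1 x2 : X) : R :=
  `|(`|x2| `^ (1 - p))^-1 *: x1 - (`|x1| `^ (1 - p))^-1 *: x2|.

(* The supremum is taken in [\bar R], so that no boundedness is presupposed. *)
Definition maligranda_rooin (R : realType) (X : normedModType R) (p : R) :
    \bar R :=
  ereal_sup [set (p_angular_dist p x.1 x.2 / skew_p_angular_dist p x.1 x.2)%:E
            | x in [set x : X * X | [/\ x.1 != 0, x.2 != 0 &
                                      skew_p_angular_dist p x.1 x.2 != 0]]].

Definition linearly_independent (R : pzRingType) (V : lmodType R) (n : nat)
    (v : 'I_n -> V) : Prop :=
  forall a : 'I_n -> R, \sum_(i < n) a i *: v i = 0 -> forall i, a i = 0.

(* [V] may be infinite-dimensional, hence no [\dim], which needs a [vectType]. *)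
Definition dim_ge (R : pzRingType) (V : lmodType R) (n : nat) : Prop :=
  exists v : 'I_n -> V, linearly_independent v.

(* Over the reals, [{dot X for idfun}] is the type of symmetric positive
   definite bilinear forms on [X]. *)
Definition is_inner_product_space (R : realType) (X : normedModType R) : Prop :=
  exists f : {dot X for (@idfun R)}, forall x : X, `|x| ^+ 2 = f x x.

Arguments maligranda_rooin {R} X p.
Arguments dim_ge {R} V n.
Arguments is_inner_product_space {R} X.

(* Main.v *)
(* If [alpha_p <= beta_p] with [p < 1], apply this to [e^k u] and [- e^(-k) v]
   with [u], [v] unit vectors: [D s = |e^s u + e^(-s) v|] satisfies
   [D (k p) <= D (k (2 - p))]. Iterating, [D] is minimal at [0], i.e.
   [|u + v| <= |t u + v / t|] for all [t > 0] as soon as [|u| = |v|] (Lorch).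
   This says that isosceles orthogonality implies Birkhoff orthogonality.
   Together with the strict convexity it entails, every two vectors of equal norm
   are exchanged by a linear isometry of the plane they span (Ficken), and so many
   reflections force the unit circle of each plane to be an ellipse. The inner
   product is then given by polarization. Conversely, in an inner product space
   [beta_p^2 - alpha_p^2] is
   [(|x|^2 - |y|^2) (|y|^(-2(1-p)) - |x|^(-2(1-p))) >= 0]. *)
From HB Require Import structures.
Require Import Defs.
From mathcomp Require Import all_boot all_order all_algebra.
From mathcomp Require Import all_classical all_reals all_analysis.
From mathcomp Require Import ring lra.

Set Implicit Arguments.
Unset Strict Implicit.
Unset Printing Implicit Defensive.

Import Order.TTheory GRing.Theory Num.Theory.
Import numFieldNormedType.Exports.

Local Open Scope classical_set_scope.
Local Open Scope ring_scope.

(** * Identities between linear combinations *)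

Section LinearCombinations.
Variables (R : comPzRingType) (V : lmodType R) (u v w : V).

Lemma comb_eq (z z' : V) (a b c a' b' c' : R) :
  z = a *: u + b *: v + c *: w -> z' = a' *: u + b' *: v + c' *: w ->
  a = a' -> b = b' -> c = c' -> z = z'.
Proof. by move=> -> -> -> -> ->. Qed.

Lemma comb1 : u = 1 *: u + 0 *: v + 0 *: w.
Proof. by rewrite scale1r !scale0r !addr0. Qed.

Lemma comb2 : v = 0 *: u + 1 *: v + 0 *: w.
Proof. by rewrite scale1r !scale0r addr0 add0r. Qed.

Lemma comb3 : w = 0 *: u + 0 *: v + 1 *: w.
Proof. by rewrite scale1r !scale0r !add0r. Qed.

Lemma comb0 : 0 = 0 *: u + 0 *: v + 0 *: w.
Proof. by rewrite !scale0r !addr0. Qed.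

Lemma combD (z z' : V) (a b c a' b' c' : R) :
  z = a *: u + b *: v + c *: w -> z' = a' *: u + b' *: v + c' *: w ->
  z + z' = (a + a') *: u + (b + b') *: v + (c + c') *: w.
Proof. by move=> -> ->; rewrite !scalerDl addrACA [in LHS](addrACA (a *: u)). Qed.

Lemma combZ (k : R) (z : V) (a b c : R) :
  z = a *: u + b *: v + c *: w ->
  k *: z = (k * a) *: u + (k * b) *: v + (k * c) *: w.
Proof. by move=> ->; rewrite !scalerDr !scalerA. Qed.

Lemma combN (z : V) (a b c : R) :
  z = a *: u + b *: v + c *: w -> - z = (- a) *: u + (- b) *: v + (- c) *: w.
Proof. by move=> ->; rewrite !opprD !scaleNr. Qed.

End LinearCombinations.

(* Proves an identity between linear combinations of [u], [v], [w] by comparing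
   coefficients, leaving those [ring] cannot settle. *)
Ltac comb u v w :=
  first [ exact: (@comb1 _ _ u v w) | exact: (@comb2 _ _ u v w)
        | exact: (@comb3 _ _ u v w) | exact: (@comb0 _ _ u v w)
        | (eapply (@combD _ _ u v w); [comb u v w | comb u v w])
        | (eapply (@combN _ _ u v w); comb u v w)
        | (eapply (@combZ _ _ u v w); comb u v w) ].
Ltac lin3 u v w :=
  eapply (@comb_eq _ _ u v w);
  [ comb u v w | comb u v w | try ring | try ring | try ring ].
Ltac lin2 u v := lin3 u v u.

(** * Existence of isosceles orthogonal vectors *)

Section NormedPlane.
Variables (R : realType) (X : normedModType R).
Implicit Types x y z u v w : X.

(** Convexity of the norm: [z + k *: y] lies between [z] and [z + (k + 2) *: y]. *)
Lemma norm_line_mono (z y : X) (k : R) : 0 < k -> `|z| <= `|z + k *: y| ->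
  `|z + k *: y| <= `|z + (k + 2) *: y|.
Proof.
move=> k0 zk.
have : `|(k + 2) *: (z + k *: y)| <= `|2 *: z| + `|k *: (z + (k + 2) *: y)|.
  have -> : (k + 2) *: (z + k *: y) = 2 *: z + k *: (z + (k + 2) *: y) by lin2 z y.
  exact: ler_normD.
by rewrite !normrZ !gtr0_norm ?addr_gt0// => ?; rewrite -(ler_pM2l k0); nra.
Qed.

(** Intermediate value theorem: the difference of the two sides changes sign between large negative
    and large positive [c]. *)
Lemma exists_isosceles_orth (z y : X) :
  exists c : R, `|z + c *: y + y| = `|z + c *: y - y|.
Proof.
have [->|y0] := eqVneq y 0; first by exists 0; rewrite addr0 subr0.
have ny : 0 < `|y| by rewrite normr_gt0.
(* Then [k * |y| - |z|] is [|z| + |y|], which gives [far]. *)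
pose k := 2 * `|z| / `|y| + 1.
have k0 : 0 < k by rewrite ltr_wpDl// divr_ge0// mulr_ge0.
have far (t : X) : `|t| = `|y| -> `|z| <= `|z + k *: t|.
  move=> ty; have : `|k *: t| <= `|z + k *: t| + `|z|.
    by rewrite -[X in `|X| <= _](addKr z) addrC (le_trans (ler_normB _ _)).
  rewrite normrZ gtr0_norm// ty /k mulrDl divfK ?gt_eqF// mul1r.
  by move: ny; lra.
pose f c := `|z + c *: y + y| - `|z + c *: y - y|.
have fR : 0 <= f (k + 1).
  rewrite /f subr_ge0.
  have -> : z + (k + 1) *: y + y = z + (k + 2) *: y by lin2 z y.
  have -> : z + (k + 1) *: y - y = z + k *: y by lin2 z y.
  by apply: norm_line_mono => //; exact: far.
have fL : f (- (k + 1)) <= 0.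
  rewrite /f subr_le0.
  have -> : z + (- (k + 1)) *: y + y = z + k *: (- y) by lin2 z y.
  have -> : z + (- (k + 1)) *: y - y = z + (k + 2) *: (- y) by lin2 z y.
  by apply: norm_line_mono => //; apply: far; rewrite normrN.
have cf : continuous f.
  move=> c; apply: cvgB; apply: cvg_norm; (apply: cvgD; last exact: cvg_cst);
    (apply: cvgD; first exact: cvg_cst); by apply: cvgZr_tmp; exact: cvg_id.
have [|||c _ /eqP] := @IVT R f (- (k + 1)) (k + 1) 0.
- by lra.
- exact: continuous_subspaceT.
- by rewrite ge_min le_max fL fR orbT.
by rewrite subr_eq0 => /eqP; exists c.
Qed.

(** * Planes are Euclidean when isosceles orthogonality implies Birkhoff orthogonality *)

Section IsoscelesImpliesBirkhoff.
Hypothesis birkhoff : forall (x y : X), `|x + y| = `|x - y| ->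
  forall l : R, `|x| <= `|x + l *: y|.

(* If the line [x + R y] supports the sphere of radius [`|x|] along the segment
   [x, x + y], then chords from [x] to points slightly beyond the segment have
   their midpoint over the flat part, so they must be parallel to it. *)
Lemma flat_segment_extends (x y : X) : (forall l : R, `|x| <= `|x + l *: y|) ->
  `|x + y| = `|x| -> `|x + (3 / 2) *: y| = `|x|.
Proof.
move=> bxy; have [->|x0] := eqVneq x 0.
  rewrite !add0r normr0 => /eqP; rewrite normr_eq0 => /eqP ->.
  by rewrite scaler0 normr0.
move=> xy.
have nx : 0 < `|x| by rewrite normr_gt0.
have flat (l : R) : 0 <= l <= 1 -> `|x + l *: y| = `|x|.
  move=> /andP[l0 l1]; apply/le_anti; rewrite bxy andbT.
  have -> : x + l *: y = (1 - l) *: x + l *: (x + y) by lin2 x y.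
  rewrite (le_trans (ler_normD _ _))// !normrZ xy !ger0_norm ?subr_ge0//.
  by rewrite -mulrDl subrK mul1r.
apply/le_anti; rewrite bxy andbT leNgt; apply/negP => lt.
set w := x + (3 / 2) *: y in lt.
pose m := `|x| / `|w|.
have nw : 0 < `|w| by exact: lt_trans lt.
have m0 : 0 < m by rewrite divr_gt0.
have m1 : m < 1 by rewrite ltr_pdivrMr// mul1r.
have mw : `|m *: w| = `|x| by rewrite normrZ gtr0_norm// divfK ?gt_eqF.
have combE (a b : R) : 0 < a -> 0 <= b -> b <= a -> `|a *: x + b *: y| = a * `|x|.
  move=> a0 b0 ba.
  have -> : a *: x + b *: y = a *: (x + (b / a) *: y).
    by lin2 x y; field; rewrite gt_eqF.
  rewrite normrZ gtr0_norm// flat//; apply/andP; split.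
    by rewrite divr_ge0// ltW.
  by rewrite ler_pdivrMr// mul1r.
(* The factor 1/3 is the largest that keeps the new point in the cone of [combE] for every [m < 1].
   The two norms are then linear in [m], and their comparison gives [1 <= m]. *)
have := @birkhoff (m *: w + x) (m *: w - x) _ (3^-1).
have -> : m *: w + x + (m *: w - x) = 2 *: (m *: w) by lin2 x (m *: w).
have -> : m *: w + x - (m *: w - x) = 2 *: x by lin2 x (m *: w).
rewrite [`|2 *: (m *: w)|]normrZ [`|2 *: x|]normrZ mw => /(_ erefl).
have -> : m *: w + x + 3^-1 *: (m *: w - x) =
    (4 / 3 * m + 2 / 3) *: x + (2 * m) *: y by rewrite /w; lin2 x y; field.
have -> : m *: w + x = (m + 1) *: x + (3 / 2 * m) *: y by rewrite /w; lin2 x y.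
by rewrite !combE ?ler_pM2r//; lra.
Qed.

(** Extending the flat segment repeatedly by 3/2 would place arbitrarily long segments in a bounded
    sphere. *)
Lemma birkhoff_unique (x y : X) : (forall l : R, `|x| <= `|x + l *: y|) ->
  `|x + y| = `|x| -> y = 0.
Proof.
move=> bxy xy.
have flat n : `|x + (3 / 2) ^+ n *: y| = `|x|.
  elim: n => [|n ih]; first by rewrite expr0 scale1r.
  rewrite exprS -scalerA; apply: flat_segment_extends => // l.
  by rewrite scalerA.
apply/eqP; rewrite -normr_eq0 eq_le normr_ge0 andbT leNgt; apply/negP => ny.
have small n : (3 / 2) ^+ n * `|y| <= 2 * `|x|.
  have -> : (3 / 2) ^+ n * `|y| = `|(x + (3 / 2) ^+ n *: y) - x|.
    by rewrite addrC addKr normrZ ger0_norm// exprn_ge0// divr_ge0.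
  by rewrite (le_trans (ler_normB _ _))// flat; lra.
have bern n : 1 + n%:R / 2 <= (3 / 2 : R) ^+ n.
  elim: n => [|n ih]; first by rewrite mul0r addr0 expr0.
  have n0 : 0 <= n%:R :> R by [].
  by rewrite exprS -natr1; move: ih n0; set q := _ ^+ n; nra.
pose n := Num.bound (4 * `|x| / `|y|).
have : 4 * `|x| / `|y| < n%:R.
  by rewrite archi_boundP// divr_ge0// mulr_ge0.
rewrite ltr_pdivrMr// => big.
by have := small n; have := bern n; set q := _ ^+ n; nra.
Qed.

(** Some [x + c *: (t *: y)] is isosceles orthogonal to [t *: y]. Both it and [x] have minimal norm
    on the same line, so they coincide by [birkhoff_unique]. *)
Lemma isosceles_line (x y : X) : `|x + y| = `|x - y| ->
  forall t : R, `|x + t *: y| = `|x - t *: y|.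
Proof.
move=> xy t; have [->|t0] := eqVneq t 0; first by rewrite scale0r addr0 subr0.
have [c xc] := exists_isosceles_orth x (t *: y).
have b := birkhoff xc.
suff c0 : c *: (t *: y) = 0 by move: xc; rewrite c0 addr0.
apply: (@birkhoff_unique x).
  by move=> l; rewrite !scalerA; exact: birkhoff.
apply/le_anti; rewrite !scalerA birkhoff// andbT.
have := b (- c); rewrite -scalerA.
by have -> : x + c *: (t *: y) + - c *: (t *: y) = x by lin2 x y.
Qed.

(* Ficken's condition. *)
Lemma norm_swap (u v : X) : `|u| = `|v| ->
  forall a b : R, `|a *: u + b *: v| = `|b *: u + a *: v|.
Proof.
move=> uv a b.
have h (t : R) : `|(u + v) + t *: (u - v)| = `|(u + v) - t *: (u - v)|.
  apply: isosceles_line.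
  have -> : u + v + (u - v) = 2 *: u by lin2 u v.
  have -> : u + v - (u - v) = 2 *: v by lin2 u v.
  by rewrite !normrZ uv.
have [ab|ab] := eqVneq (a + b) 0.
  have -> : b = - a by apply/eqP; rewrite -addr_eq0 addrC ab.
  by rewrite -normrN; congr (`|_|); lin2 u v.
have := h ((a - b) / (a + b)).
move/(congr1 (fun r => `|(a + b) / 2| * r)); rewrite -!normrZ.
have -> : ((a + b) / 2) *: (u + v + ((a - b) / (a + b)) *: (u - v)) =
  a *: u + b *: v by lin2 u v; field.
have -> // : ((a + b) / 2) *: (u + v - ((a - b) / (a + b)) *: (u - v)) =
  b *: u + a *: v by lin2 u v; field.
Qed.

(* In the coordinates of [u, w] the reflection [S] swapping [u] and
   [v = a u + b w], with matrix [[a, c], [b, -a]] and [c = (1 - a^2) / b], and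
   its transpose are isometries. Hence so are [S S^T] and its inverse [S^T S];
   their sum is [tr (S S^T) = 2 + (b - c)^2] times the identity, and it is at
   most 2 in norm, which forces [b = c]. *)
Lemma unit_circle_euclidean (u w : X) (a b : R) :
  (forall s t : R, `|s *: u + t *: w| = `|s *: u - t *: w|) ->
  `|u| = 1 -> `|w| = 1 -> `|a *: u + b *: w| = 1 -> a ^+ 2 + b ^+ 2 = 1.
Proof.
move=> refl nu nw nv.
have [b0|b0] := eqVneq b 0.
  move: nv; rewrite b0 scale0r addr0 normrZ nu mulr1 expr0n addr0 => a1.
  by rewrite -real_normK ?num_real// a1 expr1n.
pose N s t := `|s *: u + t *: w|.
have NN s t : N s t = N s (- t) by rewrite /N scaleNr refl.
have NC s t : N s t = N t s by apply: norm_swap; rewrite nu.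
have NL s t : N s t = N (- s) t by rewrite NC NN NC.
pose c := (1 - a ^+ 2) / b.
have bc : b * c = 1 - a ^+ 2 by rewrite mulrC divfK.
(* [S] is an isometry: express [s u + t w] in [u] and [v], then swap these two. *)
have NS s t : N (a * s + c * t) (b * s - a * t) = N s t.
  have uv : `|u| = `|a *: u + b *: w| by rewrite nu nv.
  have := norm_swap uv (t / b) (s - t * a / b).
  have -> : (t / b) *: u + (s - t * a / b) *: (a *: u + b *: w) =
      (a * s + c * t) *: u + (b * s - a * t) *: w.
    by lin2 u w; rewrite /c; field.
  have -> : (s - t * a / b) *: u + (t / b) *: (a *: u + b *: w) =
      s *: u + t *: w by lin2 u w; field.
  by [].
(* The quarter turn, an isometry by [NC] and [NN], conjugates [S] to minus its transpose. *)
have NT s t : N (a * s + b * t) (c * s - a * t) = N s t.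
  by rewrite NC NN [RHS]NC [RHS]NL -[RHS]NS; congr N; ring.
have N01 : N 1 0 = 1 by rewrite /N scale1r scale0r addr0.
have P1 : N (a ^+ 2 + c ^+ 2) (a * b - a * c) = 1.
  by rewrite -N01 -(NT 1 0) -[RHS]NS; congr N; ring.
have P2 : N (a ^+ 2 + b ^+ 2) (a * c - a * b) = 1.
  by rewrite -N01 -(NS 1 0) -[RHS]NT; congr N; ring.
have : `|(2 * a ^+ 2 + b ^+ 2 + c ^+ 2) *: u| <= 2.
  have -> : (2 * a ^+ 2 + b ^+ 2 + c ^+ 2) *: u =
      ((a ^+ 2 + c ^+ 2) *: u + (a * b - a * c) *: w) +
      ((a ^+ 2 + b ^+ 2) *: u + (a * c - a * b) *: w) by lin2 u w.
  apply: le_trans (ler_normD _ _) _.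
  by move: P1 P2; rewrite /N => -> ->; lra.
rewrite normrZ nu mulr1 => /(le_trans (ler_norm _)) le2.
have /eqP : (b - c) ^+ 2 = 0.
  by apply/le_anti; rewrite sqr_ge0 andbT; nra.
by rewrite sqrf_eq0 subr_eq0 => /eqP bec; rewrite -bec in bc; lra.
Qed.

Lemma norm_comb_euclidean (u w : X) (a b : R) :
  (forall s t : R, `|s *: u + t *: w| = `|s *: u - t *: w|) ->
  `|u| = 1 -> `|w| = 1 -> `|a *: u + b *: w| ^+ 2 = a ^+ 2 + b ^+ 2.
Proof.
move=> refl nu nw; set v := a *: u + b *: w.
have [v0|v0] := eqVneq v 0.
  have v1 : a *: u - b *: w = 0 by apply/normr0_eq0; rewrite -refl -/v v0 normr0.
  have z (k : R) (t : X) : `|t| = 1 -> (2 * k) *: t = 0 -> k = 0.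
    move=> nt /eqP; rewrite scaler_eq0 -(normr_eq0 t) nt oner_eq0 orbF mulf_eq0.
    by rewrite pnatr_eq0 => /eqP.
  rewrite v0 normr0 (z a u)//; last first.
    have -> : (2 * a) *: u = v + (a *: u - b *: w) by rewrite /v; lin2 u w.
    by rewrite v0 v1 addr0.
  rewrite (z b w) ?expr0n ?addr0//.
  have -> : (2 * b) *: w = v - (a *: u - b *: w) by rewrite /v; lin2 u w.
  by rewrite v0 v1 subr0.
have nv : 0 < `|v| by rewrite normr_gt0.
have := @unit_circle_euclidean u w (a / `|v|) (b / `|v|) refl nu nw.
have -> : (a / `|v|) *: u + (b / `|v|) *: w = `|v|^-1 *: v.
  by rewrite /v; lin2 u w.
rewrite normrZ gtr0_norm ?invr_gt0// mulVf ?gt_eqF// => /(_ erefl).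
rewrite !expr_div_n -mulrDl => /(canRL (mulfVK _)) ->; rewrite ?mul1r//.
by rewrite expf_neq0 ?gt_eqF.
Qed.

(** Gram-Schmidt: [y] is replaced by some [z = y + c *: x] isosceles orthogonal to [x]. By
    [isosceles_line], changing the sign of one coordinate along [x] and [z] preserves the norm. *)
Lemma plane_euclidean (x y : X) : exists g : R, forall a b : R,
  `|a *: x + b *: y| ^+ 2 =
  a ^+ 2 * `|x| ^+ 2 + b ^+ 2 * `|y| ^+ 2 + 2 * a * b * g.
Proof.
suff [c [n h]] : exists c n : R, forall a b : R,
    `|a *: x + b *: y| ^+ 2 = (a - b * c) ^+ 2 * `|x| ^+ 2 + b ^+ 2 * n.
  exists (- c * `|x| ^+ 2) => a b; have := h 0 1.
  by rewrite scale0r add0r scale1r h => ->; ring.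
have [->|x0] := eqVneq x 0.
  exists 0, (`|y| ^+ 2) => a b.
  by rewrite scaler0 add0r normrZ normr0 exprMn real_normK ?num_real//; ring.
have [c xc] := exists_isosceles_orth y x.
set z := y + c *: x in xc.
have xy (a b : R) : a *: x + b *: y = (a - b * c) *: x + b *: z.
  by rewrite /z; lin2 x y.
have [z0|z0] := eqVneq z 0.
  exists c, 0 => a b.
  by rewrite xy z0 scaler0 addr0 normrZ exprMn real_normK ?num_real// mulr0 addr0.
exists c, (`|z| ^+ 2) => a b; rewrite xy.
have nx : 0 < `|x| by rewrite normr_gt0.
have nz : 0 < `|z| by rewrite normr_gt0.
have E (k l : R) : k *: x + l *: z =
    (k * `|x|) *: (`|x|^-1 *: x) + (l * `|z|) *: (`|z|^-1 *: z).
  by rewrite !scalerA !mulfK ?gt_eqF.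
rewrite E norm_comb_euclidean.
- by rewrite !exprMn.
- have h := isosceles_line xc.
  have h2 (s t : R) : `|s *: z + t *: x| = `|s *: z - t *: x|.
    have [->|s0] := eqVneq s 0; first by rewrite scale0r add0r sub0r normrN.
    have := h (t / s); move/(congr1 (fun r => `|s| * r)); rewrite -!normrZ.
    have -> : s *: (z + (t / s) *: x) = s *: z + t *: x by lin2 x z; field.
    by have -> // : s *: (z - (t / s) *: x) = s *: z - t *: x by lin2 x z; field.
  by move=> s t; rewrite !scalerA addrC h2 -normrN opprB.
- by rewrite normrZ gtr0_norm ?invr_gt0// mulVf ?gt_eqF.
- by rewrite normrZ gtr0_norm ?invr_gt0// mulVf ?gt_eqF.
Qed.

End IsoscelesImpliesBirkhoff.

End NormedPlane.

(** * From Lorch's inequality to Birkhoff orthogonality *)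

Section LorchImpliesBirkhoff.
Variables (R : realType) (X : normedModType R).
Hypothesis lorch : forall u v : X, `|u| = `|v| ->
  forall t : R, 0 < t -> `|u + v| <= `|t *: u + t^-1 *: v|.

Lemma isosceles_birkhoff_near (x y : X) (s : R) : `|x + y| = `|x - y| ->
  s ^+ 2 < 1 -> (1 - s ^+ 2) * `|x| <= `|x + s *: y|.
Proof.
move=> xy s1; have [s_lt s_gt] : 0 < 1 + s /\ 0 < 1 - s by split; nra.
(* This [t] makes [t (x + y) + (x - y) / t] a multiple of [x + s y]. The resulting factor [r], the
   root of [1 - s^2], is weakened to [1 - s^2]. *)
pose t := Num.sqrt ((1 + s) / (1 - s)); pose r := (1 + s) / t.
have q0 : 0 < (1 + s) / (1 - s) by rewrite divr_gt0.
have t0 : 0 < t by rewrite sqrtr_gt0.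
have tt : t ^+ 2 = (1 + s) / (1 - s) by rewrite sqr_sqrtr// ltW.
have r0 : 0 < r by rewrite divr_gt0.
have rt : r * t = 1 + s by rewrite divfK// gt_eqF.
have rt' : r / t = 1 - s.
  by rewrite /r -mulrA -invfM -expr2 tt; field; rewrite !gt_eqF.
have rr : r ^+ 2 = 1 - s ^+ 2.
  have -> : r ^+ 2 = (r * t) * (r / t) by field; rewrite gt_eqF.
  by rewrite rt rt'; ring.
have r_ge : 1 - s ^+ 2 <= r by rewrite -rr; nra.
apply: le_trans (_ : r * `|x| <= _); first by rewrite ler_wpM2r.
have := lorch xy t0; have -> : x + y + (x - y) = 2 *: x by lin2 x y.
rewrite -(ler_pM2l r0) -[X in _ <= X * _](gtr0_norm r0) -normrZ.
have -> : r *: (t *: (x + y) + t^-1 *: (x - y)) = 2 *: (x + s *: y).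
  rewrite scalerDr !scalerA rt rt'; lin2 x y.
by rewrite !normrZ gtr0_norm// mulrCA ler_pM2l.
Qed.

(** A drop [d] at [l] would, by convexity, cause a drop of at least [s * d] at [s * l], whereas
    [isosceles_birkhoff_near] allows only a second-order drop in [s]. *)
Lemma isosceles_birkhoff (x y : X) : `|x + y| = `|x - y| ->
  forall l : R, `|x| <= `|x + l *: y|.
Proof.
move=> xy l; rewrite leNgt; apply/negP => lt.
pose d := `|x| - `|x + l *: y|.
have d0 : 0 < d by rewrite subr_gt0.
have x0 : 0 <= `|x| by [].
have l0 : 0 <= l ^+ 2 by rewrite sqr_ge0.
(* Large enough for [s = d / D] to satisfy [s1], [sl1] and [sld] together. *)
pose D := d + 1 + l ^+ 2 * (`|x| + 1 + d).
have D0 : 0 < D by rewrite /D; nra.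
pose s := d / D.
have s0 : 0 < s by rewrite divr_gt0.
have s1 : s < 1 by rewrite ltr_pdivrMr// mul1r /D; nra.
have sl1 : s * l ^+ 2 < 1.
  by rewrite mulrAC ltr_pdivrMr// mul1r /D; nra.
have sld : s * l ^+ 2 * `|x| < d.
  rewrite /s -mulrA mulrAC ltr_pdivrMr// ltr_pM2l// /D; nra.
clearbody s.
have /(isosceles_birkhoff_near xy) : (s * l) ^+ 2 < 1 by rewrite exprMn; nra.
have -> : x + (s * l) *: y = (1 - s) *: x + s *: (x + l *: y) by lin2 x y.
move=> /le_trans /(_ (ler_normD _ _)).
rewrite !normrZ (ger0_norm (ltW s0)) ger0_norm ?subr_ge0 ?(ltW s1)// exprMn.
have -> : `|x + l *: y| = `|x| - d by rewrite /d; ring.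
by nra.
Qed.

End LorchImpliesBirkhoff.

(** * Inner product by polarization *)

Section Polarization.
Variables (R : realType) (X : normedModType R).
Hypothesis plane : forall x y : X, exists g : R, forall a b : R,
  `|a *: x + b *: y| ^+ 2 =
  a ^+ 2 * `|x| ^+ 2 + b ^+ 2 * `|y| ^+ 2 + 2 * a * b * g.

Definition polar (x y : X) : R := (`|x + y| ^+ 2 - `|x - y| ^+ 2) / 4.

Lemma norm_comb_polar (x y : X) (a b : R) : `|a *: x + b *: y| ^+ 2 =
  a ^+ 2 * `|x| ^+ 2 + b ^+ 2 * `|y| ^+ 2 + 2 * a * b * polar x y.
Proof.
have [g h] := plane x y; rewrite h; congr (_ + _ * _); rewrite /polar.
have := h 1 1; have := h 1 (-1); rewrite scaleN1r !scale1r => -> ->.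
by field.
Qed.

Lemma polarC x y : polar x y = polar y x.
Proof. by rewrite /polar (addrC x) -[x - y]opprB normrN. Qed.

Lemma polarZl k x y : polar (k *: x) y = k * polar x y.
Proof.
rewrite {1}/polar; have := norm_comb_polar x y k 1.
have := norm_comb_polar x y k (-1).
by rewrite scaleN1r !scale1r => -> ->; field.
Qed.

Lemma parallelogram (x y : X) :
  `|x + y| ^+ 2 + `|x - y| ^+ 2 = 2 * `|x| ^+ 2 + 2 * `|y| ^+ 2.
Proof.
have := norm_comb_polar x y 1 1; have := norm_comb_polar x y 1 (-1).
by rewrite scaleN1r !scale1r => -> ->; ring.
Qed.

(** Jordan-von Neumann: subtract the parallelogram laws for [x + z, y + z] and [x - z, y - z], then
    halve by homogeneity. *)
Lemma polarDl x y z : polar (x + y) z = polar x z + polar y z.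
Proof.
have : polar (x + y) (2 *: z) = 2 * polar (x + y) z.
  by rewrite polarC polarZl polarC.
rewrite {1}/polar.
have := parallelogram (x + z) (y + z); have := parallelogram (x - z) (y - z).
have -> : x - z + (y - z) = x + y - 2 *: z by lin3 x y z.
have -> : x - z - (y - z) = x - y by lin3 x y z.
have -> : x + z + (y + z) = x + y + 2 *: z by lin3 x y z.
have -> : x + z - (y + z) = x - y by lin3 x y z.
rewrite /(polar x z) /(polar y z); lra.
Qed.

Lemma polar_bilinear : bilinear_for *%R (idfun \; *%R) polar.
Proof.
split=> [z|z] k x y /=; first by rewrite polarDl polarZl.
by rewrite polarC polarDl polarZl ![polar _ z]polarC.
Qed.

Lemma polarxx x : polar x x = `|x| ^+ 2.
Proof.
rewrite /polar subrr normr0 -[x + x]mulr2n -scaler_nat normrZ ger0_norm//.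
by field.
Qed.

Lemma polar_hermitian x y : polar x y = (-1) ^+ false * idfun (polar y x).
Proof. by rewrite expr0 mul1r polarC. Qed.

Lemma polar_gt0 x : x != 0 -> 0 < polar x x.
Proof. by move=> x0; rewrite polarxx exprn_gt0// normr_gt0. Qed.

Lemma polarization : is_inner_product_space X.
Proof.
pose bil := bilinear_isBilinear.Build R X X R _ _ polar polar_bilinear.
pose herm := isHermitianSesquilinear.Build R X false idfun polar polar_hermitian.
pose dot := isDotProduct.Build R X polar polar_gt0.
pose f : {dot X for (@idfun R)} := HB.pack polar bil herm dot.
by exists f => x; rewrite -polarxx.
Qed.

End Polarization.

(** * Angular distances and both implications *)

Section AngularDistances.
Variables (R : realType) (X : normedModType R) (p : R).
Hypotheses (p_ge0 : 0 <= p) (p_le1 : p <= 1).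

(** Handles the pairs excluded from the supremum: comparing norms gives [|x|^(2-p) = |y|^(2-p)]. *)
Lemma skew_p_angular_dist_eq0 (x y : X) : x != 0 -> y != 0 ->
  skew_p_angular_dist p x y = 0 -> `|x| = `|y|.
Proof.
move=> x0 y0 /normr0_eq0/eqP; rewrite subr_eq0 => /eqP/(congr1 (fun t : X => `|t|)) /=.
have nx : 0 < `|x| by rewrite normr_gt0.
have ny : 0 < `|y| by rewrite normr_gt0.
have px : 0 < `|x| `^ (1 - p) by exact: powR_gt0.
have py : 0 < `|y| `^ (1 - p) by exact: powR_gt0.
rewrite !normrZ !gtr0_norm ?invr_gt0//.
move/(congr1 (fun r => r * (`|x| `^ (1 - p) * `|y| `^ (1 - p)))).
have -> : (`|y| `^ (1 - p))^-1 * `|x| * (`|x| `^ (1 - p) * `|y| `^ (1 - p)) =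
    `|x| * `|x| `^ (1 - p) by field; rewrite gt_eqF.
have -> : (`|x| `^ (1 - p))^-1 * `|y| * (`|x| `^ (1 - p) * `|y| `^ (1 - p)) =
    `|y| * `|y| `^ (1 - p) by field; rewrite gt_eqF.
have E (t : R) : 0 < t -> t * t `^ (1 - p) = t `^ (2 - p).
  move=> t0; rewrite -{1}(powRr1 (ltW t0)) -powRD ?(gt_eqF t0) ?implybT//.
  by congr (_ `^ _); ring.
rewrite !E// => /(@powR_injective _ (2 - p)); apply; rewrite ?nnegrE//.
by move: p_le1; lra.
Qed.

Lemma p_angular_dist_le_skew (x y : X) : maligranda_rooin X p = 1%:E ->
  x != 0 -> y != 0 -> p_angular_dist p x y <= skew_p_angular_dist p x y.
Proof.
move=> MR x0 y0.
have [/(skew_p_angular_dist_eq0 x0 y0) xy|b0] :=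
  eqVneq (skew_p_angular_dist p x y) 0.
  by rewrite /p_angular_dist /skew_p_angular_dist xy.
have : ((p_angular_dist p x y / skew_p_angular_dist p x y)%:E <=
    maligranda_rooin X p)%E by apply: ereal_sup_ubound; exists (x, y).
rewrite MR lee_fin ler_pdivrMr ?mul1r// lt_neqAle eq_sym b0.
exact: normr_ge0.
Qed.

Lemma exp_dist_le (u v : X) (k : R) : maligranda_rooin X p = 1%:E ->
  `|u| = 1 -> `|v| = 1 ->
  `|expR (k * p) *: u + expR (- (k * p)) *: v| <=
  `|expR (k * (2 - p)) *: u + expR (- (k * (2 - p))) *: v|.
Proof.
move=> MR nu nv.
have nz (t : X) (a : R) : `|t| = 1 -> expR a *: t != 0.
  by move=> nt; rewrite scaler_eq0 expR_eq0 -normr_eq0 nt oner_eq0.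
have := p_angular_dist_le_skew MR (nz u k nu) (nz (- v) (- k) _).
rewrite normrN => /(_ nv).
rewrite /p_angular_dist /skew_p_angular_dist !normrZ normrN nu nv !mulr1.
rewrite !ger0_norm ?expR_ge0// -!expRM -!expRN !scalerA -!expRD.
rewrite !scalerN !opprK.
have -> : - (k * (1 - p)) + k = k * p by ring.
have -> : - (- k * (1 - p)) + - k = - (k * p) by ring.
have -> : - (- k * (1 - p)) + k = k * (2 - p) by ring.
by have -> : - (k * (1 - p)) + - k = - (k * (2 - p)) by ring.
Qed.

Lemma exp_dist_min (u v : X) (s : R) : p < 1 -> maligranda_rooin X p = 1%:E ->
  `|u| = 1 -> `|v| = 1 -> `|u + v| <= `|expR s *: u + expR (- s) *: v|.
Proof.
move=> p_lt1 MR nu nv.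
pose D r := `|expR r *: u + expR (- r) *: v|; rewrite -/(D s).
have p2 : 2 - p != 0 by apply/lt0r_neq0; lra.
(* Contraction ratio between the two arguments of [D]; [p < 1] makes it less than 1, so [q ^+ n * s]
   tends to 0. *)
pose q := p / (2 - p).
have q0 : 0 <= q by rewrite divr_ge0//; move: p_le1; lra.
have q1 : q < 1 by rewrite ltr_pdivrMr; move: p_lt1; lra.
have step r : D (q * r) <= D r.
  have := exp_dist_le (r / (2 - p)) MR nu nv.
  by rewrite mulfVK// -/(D r) mulrAC -mulrA [r * _]mulrC.
have iter n : D (q ^+ n * s) <= D s.
  elim: n => [|n ih]; first by rewrite mul1r.
  by rewrite exprS -mulrA (le_trans (step _)).
have cD : continuous D.
  move=> r; apply: cvg_norm; apply: cvgD; apply: cvgZr_tmp.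
    exact: continuous_expR.
  apply: (@continuous_comp _ _ _ -%R expR); first exact: opp_continuous.
  exact: continuous_expR.
have lim0 : (fun n => q ^+ n * s) @ \oo --> (0 : R).
  rewrite -(mul0r s); apply: cvgMr_tmp; apply: cvg_expr.
  by rewrite ger0_norm.
have -> : `|u + v| = D 0 by rewrite /D oppr0 expR0 !scale1r.
have limD : D (q ^+ n * s) @[n --> \oo] --> D 0.
  exact: (continuous_cvg _ (cD 0) lim0).
rewrite -(cvg_lim _ limD)//; apply: limr_le; last exact: nearW.
by apply/cvg_ex; exists (D 0).
Qed.

Lemma lorch_of_maligranda_rooin (u v : X) (t : R) : p < 1 ->
  maligranda_rooin X p = 1%:E -> `|u| = `|v| -> 0 < t ->
  `|u + v| <= `|t *: u + t^-1 *: v|.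
Proof.
move=> p_lt1 MR uv t0.
have [u0|u0] := eqVneq u 0.
  have -> : v = 0 by apply: normr0_eq0; rewrite -uv u0 normr0.
  by rewrite u0 addr0 normr0.
have nu : 0 < `|u| by rewrite normr_gt0.
have nv : 0 < `|v| by rewrite -uv.
have := @exp_dist_min (`|u|^-1 *: u) (`|u|^-1 *: v) (ln t) p_lt1 MR.
rewrite expRN lnK// !scalerA ![_ * `|u|^-1]mulrC -!scalerA -!scalerDr !normrZ.
rewrite gtr0_norm ?invr_gt0// -uv mulVf ?gt_eqF//.
by move=> /(_ erefl erefl); rewrite ler_pM2l// invr_gt0.
Qed.

Lemma inner_product_of_maligranda_rooin : p < 1 ->
  maligranda_rooin X p = 1%:E -> is_inner_product_space X.
Proof.
move=> p_lt1 MR; apply: polarization => x y; apply: plane_euclidean.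
apply: isosceles_birkhoff => u v uv t; exact: lorch_of_maligranda_rooin.
Qed.

Lemma p_angular_dist_le_skew_dot (x y : X) : is_inner_product_space X ->
  x != 0 -> y != 0 -> p_angular_dist p x y <= skew_p_angular_dist p x y.
Proof.
move=> [f fE] x0 y0; rewrite -(ler_pXn2r (n := 2))// ?nnegrE ?normr_ge0//.
have nx : 0 < `|x| by rewrite normr_gt0.
have ny : 0 < `|y| by rewrite normr_gt0.
have expand (a b : R) : `|a *: x - b *: y| ^+ 2 =
    a ^+ 2 * `|x| ^+ 2 + b ^+ 2 * `|y| ^+ 2 - 2 * a * b * f x y.
  rewrite !fE linearBl !linearBr !linearZl_LR !linearZr_LR /=.
  have -> : f y x = f x y by rewrite hermC expr0 mul1r.
  by rewrite /GRing.scale /=; ring.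
rewrite !expand.
set A := (`|x| `^ (1 - p))^-1; set B := (`|y| `^ (1 - p))^-1.
have A0 : 0 < A by rewrite invr_gt0 powR_gt0.
have B0 : 0 < B by rewrite invr_gt0 powR_gt0.
have mono (a b : R) : 0 < a -> a <= b ->
    (b `^ (1 - p))^-1 <= (a `^ (1 - p))^-1.
  move=> a0 ab; have b0 := lt_le_trans a0 ab.
  rewrite lef_pV2 ?posrE ?powR_gt0//.
  by apply: ge0_ler_powR; rewrite ?nnegrE ?subr_ge0// ltW.
(* The cross terms in [f x y] cancel, both having coefficient [- 2 * A * B]. *)
suff : 0 <= (`|x| ^+ 2 - `|y| ^+ 2) * (B ^+ 2 - A ^+ 2) by lra.
have [xy|/ltW xy] := leP `|x| `|y|.
- have := mono _ _ nx xy; rewrite -/A -/B => BA.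
  by rewrite mulr_le0// subr_le0 lerXn2r// ?nnegrE// ltW.
- have := mono _ _ ny xy; rewrite -/A -/B => AB.
  by rewrite mulr_ge0// subr_ge0 lerXn2r// ?nnegrE// ltW.
Qed.

Lemma maligranda_rooin_of_inner_product : dim_ge X 2 ->
  is_inner_product_space X -> maligranda_rooin X p = 1%:E.
Proof.
move=> [e indep] ips; apply/le_anti/andP; split.
  apply: ge_ereal_sup => _ [[x y] /= [x0 y0 b0] <-].
  rewrite lee_fin ler_pdivrMr ?mul1r ?p_angular_dist_le_skew_dot//.
  by rewrite lt_neqAle eq_sym b0 normr_ge0.
(* The value 1 is attained at [(v, - v)], where equal norms make the two distances agree. *)
pose v := e ord0.
have v0 : v != 0.
  apply/eqP => v0; have := indep (fun i => (i == ord0)%:R).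
  rewrite big_ord_recl big_ord1 /= -/v v0 scaler0 add0r scale0r.
  by move=> /(_ erefl ord0) /eqP; rewrite oner_eq0.
have b0 : skew_p_angular_dist p v (- v) != 0.
  rewrite /skew_p_angular_dist normrN scalerN opprK -mulr2n -scaler_nat normr_eq0.
  rewrite !scaler_eq0 pnatr_eq0 (negbTE v0) orbF invr_eq0 /=.
  by rewrite gt_eqF// powR_gt0 ?normr_gt0.
apply: ereal_sup_ubound; exists (v, - v); first by rewrite /= oppr_eq0.
have -> : p_angular_dist p v (- v) = skew_p_angular_dist p v (- v).
  by rewrite /p_angular_dist /skew_p_angular_dist normrN.
by rewrite divff.
Qed.

End AngularDistances.

(* For p = 1 the two distances coincide, so the constant is 1 for every X and
   the backward implication fails; it is therefore stated for p < 1. *)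
Theorem theorem3p1 (R : realType) (X : normedModType R) (p : R)
    (dimX : dim_ge X 2) (p_ge0 : 0 <= p) (p_le1 : p <= 1) :
  (is_inner_product_space X -> maligranda_rooin X p = 1%:E) /\
  (p < 1 -> maligranda_rooin X p = 1%:E -> is_inner_product_space X).
Proof.
split; first exact: maligranda_rooin_of_inner_product.
exact: inner_product_of_maligranda_rooin.
Qed.
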